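(* Let $p\ge3$ be a prime and let $G$ be a graph. Let $G^{(p-2)}$ be the multigraph obtained from $G$ by replacing each edge with $p-2$ parallel edges, and let $H$ be a spanning subgraph of $G^{(p-2)}$ with exactly $(p-1)(|V(G)|-1)$ edges. If, for some $u\in V(H)$, $H$ has an orientation $D$ in which $\deg^+_D(v)=p-1$ for each $v\in V(G)\setminus\{u\}$ and such that $EE(D)-EO(D)\not\equiv 0\pmod p$, then $G$ is $\mathbb Z_p$-connected.
   Context: For an orientation $D$ of a (multi)graph $H$, a spanning subgraph of $H$ (a subset of its edges) is Eulerian with respect to $D$ if every vertex has equal in-degree and out-degree in the restriction of $D$ to that subgraph; it is even or odd according to the parity of its number of edges. $EE(D)$ and $EO(D)$ denote the numbers of even and odd Eulerian subgraphs with respect to $D$. A graph $G$ (with an arbitrary fixed orientation, giving out-arcs $E^+(v)$ and in-arcs $E^-(v)$ at each vertex) is $\mathbb Z_p$-connected if for every $b:V(G)\to\mathbb Z_p$ with $\sum_{v}b(v)=0$ there exists $\phi:E(G)\to\mathbb Z_p\setminus\{0\}$ with $\sum_{e\in E^+(v)}\phi(e)-\sum_{e\in E^-(v)}\phi(e)=b(v)$ for all $v\in V(G)$. *)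

(* Defs.v *)
From HB Require Import structures.
From mathcomp Require Import all_boot all_order all_algebra.

Set Implicit Arguments.
Unset Strict Implicit.
Unset Printing Implicit Defensive.

Import GRing.Theory.
Local Open Scope ring_scope.

(* Finite undirected graphs; parallel edges are allowed, and a loop at v has
   set of ends [set v]. *)
Record graph := Graph {
  vertex : finType;
  edge : finType;
  ends : edge -> {set vertex};
  ends_card : forall e, (0 < #|ends e| <= 2)%N
}.

Record orientation (G : graph) := Orientation {
  tail : edge G -> vertex G;
  head : edge G -> vertex G;
  ends_orientation : forall e, ends e = [set tail e; head e]
}.

Definition multiply (G : graph) (k : nat) : graph :=
  @Graph (vertex G) (edge G * 'I_k)%type (fun e => ends e.1)
         (fun e => ends_card e.1).

(* The graph with all the vertices of G whose edges are those in F. *)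
Definition spanning_subgraph (G : graph) (F : {set edge G}) : graph :=
  @Graph (vertex G) {e : edge G | e \in F} (fun e => ends (val e))
         (fun e => ends_card (val e)).

Section Eulerian.
Variables (G : graph) (D : orientation G).
Implicit Types (A : {set edge G}) (v : vertex G).

Definition outdeg_in A v : nat := #|[set e in A | tail D e == v]|.
Definition indeg_in A v : nat := #|[set e in A | head D e == v]|.
Definition outdeg v : nat := outdeg_in [set: edge G] v.

Definition eulerian A : bool := [forall v, indeg_in A v == outdeg_in A v].

Definition EE : nat := #|[set A : {set edge G} | eulerian A & ~~ odd #|A|]|.
Definition EO : nat := #|[set A : {set edge G} | eulerian A & odd #|A|]|.

End Eulerian.

Definition connected_wrt (A : zmodType) (G : graph) (D : orientation G) : Prop :=
  forall b : vertex G -> A, \sum_v b v = 0 ->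
  exists phi : edge G -> A,
    (forall e, phi e != 0) /\
    (forall v, \sum_(e | tail D e == v) phi e
               - \sum_(e | head D e == v) phi e = b v).

(* The reference orientation is arbitrary: by [orientation_exists] and
   [connected_wrt_indep] below, quantifying over all of them is the same as
   fixing one. *)
Definition group_connected (A : zmodType) (G : graph) : Prop :=
  forall D : orientation G, connected_wrt A D.

Lemma orientation_exists (G : graph) : inhabited (orientation G).
Proof.
have ex_ends (e : edge G) :
    exists xy : vertex G * vertex G, ends e == [set xy.1; xy.2].
  have /andP[lt0 le2] := ends_card e.
  have [/eqP/cards1P[x ->]|ne1] := eqVneq #|ends e| 1%N.
    by exists (x, x); rewrite /= setUid.
  have /cards2P[x [y [_ ->]]] : #|ends e| == 2%N by case: #|_| lt0 le2 ne1 => [|[|[|]]].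
  by exists (x, y).
by constructor; exists (fun e => (xchoose (ex_ends e)).1)
  (fun e => (xchoose (ex_ends e)).2) => e; exact/eqP/(xchooseP (ex_ends e)).
Qed.

Lemma connected_wrt_indep (A : zmodType) (G : graph) (D D' : orientation G) :
  connected_wrt A D -> connected_wrt A D'.
Proof.
move=> conD b /conD[phi [phi0 phiE]].
exists (fun e => if tail D e == tail D' e then phi e else - phi e); split.
  by move=> e; case: ifP => _; rewrite ?oppr_eq0.
move=> v; rewrite -phiE !(big_mkcond (fun e => _ == v)) /= -!sumrB.
apply: eq_bigr => e _.
have := ends_orientation D e; rewrite (ends_orientation D' e) => /setP eD.
have [eqt|net] := eqVneq (tail D e) (tail D' e).
  suff -> : head D' e = head D e by rewrite eqt.
  have := eD (head D e); have := eD (head D' e).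
  rewrite !inE !eqxx !orbT eqt.
  case/esym/orP=> /eqP eh' // /orP[]/eqP eh; last by rewrite eh.
  by rewrite eh' eh.
have := eD (tail D e); rewrite !inE eqxx (negPf net) /= => /eqP eth.
have := eD (tail D' e); rewrite !inE eqxx eq_sym in net *.
rewrite (negPf net) /= => /esym/eqP ->; rewrite -eth.
by do 2 case: ifP => _; rewrite ?subr0 ?sub0r ?opprK ?subrr ?addNr.
Qed.

(* Main.v *)
(* Each edge of [G] receives a nonzero value once a set [S] of edges of [H] is chosen
   (see [copies_flow]), so it suffices that the boundaries of the 0/1 vectors
   [S] on the arcs of [D] take all values b' on V - u. If b' is not attained, then
   for every [S] the product over v != u and j in F_p^* of (boundary of S at v
   - b' v - j) vanishes. As outdeg v = p - 1 for v != u and outdeg u = 0, these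
   factors can be indexed by the edges e of [H], with v = tail e. The product thus has
   as many factors as variables, and its alternating sum over all [S] is, up to sign, the
   permanent of the incidence matrix with rows repeated, that is EE - EO times the
   number of permutations of the edges preserving tails. This number is prime
   to p since the fibres of the tail map have fewer than p elements. *)
From mathcomp Require Import all_boot all_order all_algebra all_fingroup all_solvable.
Require Import Defs.

Set Implicit Arguments.
Unset Strict Implicit.
Unset Printing Implicit Defensive.

Import GRing.Theory.

(** * Alternating sums of products of affine forms *)

Section Permanent.
Local Open Scope ring_scope.

Lemma prodr_bool (R : comNzRingType) (T : finType) (P : pred T) :
  \prod_i (P i)%:R = [forall i, P i]%:R :> R.
Proof.
case: forallP => [allP|/forallP]; first by rewrite big1 // => i _; rewrite allP.
by rewrite negb_forall => /existsP[i /negPf Ni]; rewrite (bigD1 i) //= Ni mul0r.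
Qed.

(* Expand each factor by choosing its constant or one of its variables: the signed
   sum over [S] cancels unless every variable is chosen, and then, the numbers of
   factors and of variables being equal, the choice is a permutation. *)
Lemma sum_setsign_prod_affine (R : comNzRingType) (T : finType)
    (c : T -> R) (a : T -> T -> R) :
  \sum_(S : {set T}) (-1) ^+ #|S| * \prod_i (c i + \sum_(x in S) a i x) =
  (-1) ^+ #|T| * \sum_(s : {perm T}) \prod_i a i (s i).
Proof.
pose w i (o : option T) := if o is Some x then a i x else c i.
pose inS (S : {set T}) (o : option T) := if o is Some x then x \in S else true.
pose covers (f : {ffun T -> option T}) := [forall x, [exists i, f i == Some x]].
have expand (S : {set T}) : (-1) ^+ #|S| * \prod_i (c i + \sum_(x in S) a i x) =
    \sum_(f : {ffun T -> option T})
      (\prod_i w i (f i)) * ((-1) ^+ #|S| * [forall i, inS S (f i)]%:R).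
  transitivity ((-1) ^+ #|S| * \prod_i \sum_o (inS S o)%:R * w i o).
    congr (_ * _); apply: eq_bigr => i _.
    rewrite (bigD1 None) //= mul1r; congr (_ + _).
    rewrite (reindex_onto Some (fun o => odflt i o)) /=; last by case.
    rewrite big_mkcond [RHS](eq_bigl predT); last by move=> x /=; rewrite eqxx.
    by apply: eq_bigr => x _; case: ifP; rewrite ?mul1r ?mul0r.
  rewrite bigA_distr_bigA big_distrr /=; apply: eq_bigr => f _.
  rewrite big_split /= mulrA mulrC; congr (_ * (_ * _)).
  exact: prodr_bool.
have cancel_noncovering (f : {ffun T -> option T}) :
    \sum_(S : {set T}) (-1) ^+ #|S| * [forall i, inS S (f i)]%:R =
    (-1) ^+ #|T| * (covers f)%:R :> R.
  (* For a fixed choice [f] the sum over [S] factors over [x]: membership contributes [-1], absence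
     contributes [1] provided that no factor chose [x]. *)
  transitivity (\prod_(x : T) (-1 + [forall i, f i != Some x]%:R : R)).
    rewrite bigA_distr; apply: eq_bigr => S _.
    rewrite -prodr_const big_mkcond [RHS](bigID (mem S)) [X in X * _]big_mkcond /=.
    congr (_ * _).
      by rewrite [RHS]big_mkcond; apply: eq_bigr => x _; case: ifP => // ->.
    case: forallP => [all_in|/forallP].
      rewrite big1 // => x NxS; rewrite (negPf NxS).
      case: forallP => // -[] i; apply: contraNneq NxS => fi.
      by have := all_in i; rewrite fi.
    rewrite negb_forall => /existsP[i]; case fi: (f i) => [x|] //= NxS.
    rewrite (bigD1 x) //= (negPf NxS) (_ : [forall _, _] = false) ?mul0r //.
    by apply/negP => /forallP/(_ i); rewrite fi eqxx.
  case: (boolP (covers f)) => [/forallP cov|].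
    rewrite mulr1 -prodr_const; apply: eq_bigr => x _.
    rewrite (_ : [forall _, _] = false) ?addr0 //.
    apply/negbTE; rewrite negb_forall; have /existsP[i fi] := cov x.
    by apply/existsP; exists i; rewrite fi.
  rewrite negb_forall mulr0 => /existsP[x]; rewrite negb_exists => Nx.
  by rewrite (bigD1 x) //= Nx addNr mul0r.
rewrite (eq_bigr _ (fun S _ => expand S)) exchange_big /=.
under eq_bigr do rewrite -big_distrr /= cancel_noncovering mulrCA.
rewrite -big_distrr; congr (_ * _).
under eq_bigr do rewrite mulr_natr mulrb.
rewrite -big_mkcond /=.
pose h (s : {perm T}) : {ffun T -> option T} := [ffun i => Some (s i)].
have h_inj : injective h.
  by move=> s t /ffunP st; apply/permP => i; have := st i; rewrite !ffunE => -[].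
rewrite (reindex_onto h (fun f => odflt 1%g [pick s | h s == f])) /=; last first.
  move=> f /forallP cov; case: pickP => [s /eqP //|/=].
  have ex x : exists i, f i == Some x by exact/existsP/cov.
  (* Picking for each [x] a factor that chose it gives an injection of [T], hence a permutation, and
     [f] is its inverse; so the default [1] never occurs. *)
  pose g x := xchoose (ex x).
  have fg x : f (g x) = Some x by apply/eqP/(xchooseP (ex x)).
  have g_inj : injective g by move=> x y gxy; apply: Some_inj; rewrite -!fg gxy.
  move/(_ (perm g_inj)^-1%g)/eqP => []; apply/ffunP => i; rewrite ffunE.
  by rewrite -{2}[i](permKV (perm g_inj)) permE fg.
apply: eq_big => [s|s _]; last by apply: eq_bigr => i _; rewrite ffunE.
apply/andP; split.
  apply/forallP => x; apply/existsP; exists (s^-1%g x).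
  by rewrite ffunE permKV.
by case: pickP => [t /eqP/h_inj ->|/(_ s)]; rewrite eqxx.
Qed.

End Permanent.

(** * Permutations and the fibres of a map *)

Section Fibers.

(** Match the elements of equal rank in the enumerations of the two fibres over each point. *)
Lemma eq_card_fibers_perm (T : finType) (U : eqType) (h k : T -> U) :
  (forall y, #|[pred x | h x == y]| = #|[pred x | k x == y]|) ->
  exists s : {perm T}, forall x, k (s x) = h x.
Proof.
move=> eq_hk; pose eh y := enum [pred x | h x == y]; pose ek y := enum [pred x | k x == y].
have lt_index x : (index x (eh (h x)) < size (ek (h x)))%N.
  by rewrite -cardE -eq_hk cardE index_mem mem_enum inE.
pose s x := nth x (ek (h x)) (index x (eh (h x))).
have ks x : k (s x) = h x.
  by have := mem_nth x (lt_index x); rewrite mem_enum inE => /eqP.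
have s_inj : injective s.
  move=> x y sxy; have hxy : h x = h y by rewrite -!ks sxy.
  have lx := lt_index x; have ly := lt_index y; rewrite hxy in lx.
  move: sxy; rewrite /s hxy (set_nth_default y x lx) => /eqP.
  rewrite nth_uniq ?enum_uniq //.
  move=> /eqP exy.
  have xin : x \in eh (h y) by rewrite mem_enum inE hxy.
  have yin : y \in eh (h y) by rewrite mem_enum inE.
  by rewrite -(nth_index x xin) exy nth_index.
by exists (perm s_inj) => x; rewrite permE ks.
Qed.

(** Otherwise Cauchy gives a fibre-preserving permutation of order [p]; its orbits have size
    dividing [p] and less than [p], so it is the identity. *)
Lemma prime_ndvd_card_fiber_perm (T U : finType) (k : T -> U) (p : nat) :
  prime p -> (forall y, #|[pred x | k x == y]| < p)%N ->
  ~~ (p %| #|[set s : {perm T} | [forall x, k (s x) == k x]]|)%N.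
Proof.
move=> p_pr lt_fib; set P := [set s | _].
have Pgroup : group_set P.
  apply/group_setP; split=> [|s t].
    by rewrite inE; apply/forallP => x; rewrite perm1.
  rewrite !inE => /forallP Ps /forallP Pt; apply/forallP => x.
  by rewrite permM (eqP (Pt _)) Ps.
apply/negP => /(Cauchy (G := Group Pgroup) p_pr) [s /= sP os].
have /eqP : s = 1%g.
  apply/permP => x; rewrite perm1.
  have sub : porbit s x \subset [pred y | k y == k x].
    apply/subsetP => y /porbitP[i ->]; rewrite inE.
    have := groupX (G := Group Pgroup) i sP.
    by rewrite inE => /forallP/(_ x).
  have lt_orb := leq_ltn_trans (subset_leq_card sub) (lt_fib _).
  have : (#|porbit s x| %| p)%N by rewrite -os porbit.unlock dvdn_orbit.
  case/primeP: p_pr => _ p_dvd /p_dvd /orP[|/eqP E]; last by rewrite E ltnn in lt_orb.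
  case/cards1P => z Ez; have := mem_porbit s 1 x; have := porbit_id s x.
  by rewrite Ez !inE expg1 => /eqP xz /eqP sxz; rewrite sxz -xz.
by rewrite -order_eq1 os; case: p p_pr {lt_fib os} => [|[]].
Qed.

End Fibers.

(** * Eulerian subgraphs and boundaries of arc sets *)

Section Orientation.
Local Open Scope ring_scope.
Variables (G : graph) (D : orientation G).

Definition reorient (J : {set edge G}) (e : edge G) : vertex G :=
  if e \in J then head D e else tail D e.

(** Reversing the arcs in [J] changes the out-degree at [v] by the in-degree minus the out-degree of
    [J] there. *)
Lemma eulerian_reorientP (J : {set edge G}) :
  reflect (forall v, #|[pred e | reorient J e == v]| = #|[pred e | tail D e == v]|)
          (eulerian D J).
Proof.
have eq_in v : (#|[pred e | reorient J e == v]| == #|[pred e | tail D e == v]|) =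
    (indeg_in D J v == outdeg_in D J v).
  rewrite -(cardID (mem J) [pred e | reorient J e == v]).
  rewrite -(cardID (mem J) [pred e | tail D e == v]).
  rewrite [X in (_ + X == _)%N](_ : _ = #|[predD [pred e | tail D e == v] & J]|).
    rewrite eqn_add2r; congr (_ == _); apply: eq_card => e; rewrite !inE andbC //.
    by rewrite /reorient; case: (e \in J).
  by apply: eq_card => e; rewrite !inE /reorient; case: (e \in J).
apply: (iffP forallP) => [eul v|eqf v]; first by apply/eqP; rewrite eq_in eul.
by rewrite -eq_in eqf.
Qed.

Lemma card_perm_tail_eq_reorient (J : {set edge G}) :
  #|[set s : {perm edge G} | [forall e, tail D (s e) == reorient J e]]| =
  (eulerian D J * #|[set s : {perm edge G} | [forall e, tail D (s e) == tail D e]]|)%N.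
Proof.
case: eulerian_reorientP => [/eq_card_fibers_perm[s0 s0P]|Neul].
  rewrite mul1n -(card_preimset _ (mulgI s0)); apply: eq_card => s; rewrite !inE.
  apply/forallP/forallP => H e; last first.
    by rewrite permM (eqP (H _)) s0P.
  have := H (s0^-1%g e); rewrite permM permKV => /eqP ->.
  by rewrite -s0P permKV.
apply: eq_card0 => s; rewrite inE; apply/negP => /forallP H; apply: Neul => v.
rewrite -[RHS]cardsE -(card_preimset _ (@perm_inj _ s)).
by apply: eq_card => e; rewrite !inE (eqP (H e)).
Qed.

(* Expanding a row entry chooses the tail or the head of an edge, that is, an
   orientation [reorient J]; the permutations compatible with [J] form a coset of
   those preserving [tail D] when [J] is Eulerian, and do not exist otherwise. *)
Lemma permanent_incidence (R : comNzRingType) :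
  \sum_(s : {perm edge G})
    \prod_i ((tail D (s i) == tail D i)%:R - (head D (s i) == tail D i)%:R) =
  #|[set s : {perm edge G} | [forall e, tail D (s e) == tail D e]]|%:R
    * ((EE D)%:R - (EO D)%:R) :> R.
Proof.
(* Inverse permutations let the factors be indexed by columns, so that choosing tail or head of each
   arc amounts to choosing a set [J]. *)
rewrite (reindex_inj invg_inj) /=.
transitivity (\sum_(s : {perm edge G}) \sum_(J : {set edge G})
    (-1) ^+ #|J| * [forall e, tail D (s e) == reorient J e]%:R : R).
  apply: eq_bigr => s _; rewrite (reindex_inj (@perm_inj _ s)) /=.
  under eq_bigr do rewrite permK addrC.
  rewrite bigA_distr; apply: eq_bigr => J _.
  rewrite -prodr_bool -prodr_const [X in X * _]big_mkcond -big_split /=.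
  apply: eq_bigr => e _; rewrite /reorient [in RHS]eq_sym.
  by case: (e \in J); rewrite ?mulN1r ?mul1r.
rewrite exchange_big /=.
have sum_indicator (T : finType) (P : pred T) : \sum_i (P i)%:R = #|[set i | P i]|%:R :> R.
  by rewrite -natr_sum -sum1dep_card [in RHS]big_mkcond.
under eq_bigr do rewrite -big_distrr /= sum_indicator card_perm_tail_eq_reorient natrM mulrA.
rewrite -big_distrl mulrC /=; congr (_ * _).
rewrite /EE /EO -!sum_indicator -sumrB; apply: eq_bigr => J _.
by rewrite -signr_odd; case: eulerian; case: odd; rewrite ?mulr1 ?mulr0 ?subr0 ?sub0r.
Qed.

Lemma exists_set_boundary (p : nat) (u : vertex G) (b : vertex G -> 'F_p) :
  prime p -> (forall v, v != u -> outdeg D v = (p - 1)%N) ->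
  (forall e, tail D e != u) -> (EE D)%:R != (EO D)%:R :> 'F_p ->
  exists S : {set edge G}, forall v, v != u ->
    \sum_(e in S) ((tail D e == v)%:R - (head D e == v)%:R) = b v.
Proof.
move=> p_pr outD Nu neqE.
pose L (S : {set edge G}) v : 'F_p :=
  \sum_(e in S) ((tail D e == v)%:R - (head D e == v)%:R).
have card_fib v : v != u -> #|[pred e | tail D e == v]| = (p - 1)%N.
  by move=> /outD <-; apply: eq_card => e; rewrite !inE.
have [/existsP[S /forallP SP]|] := boolP [exists S, [forall v, (v != u) ==> (L S v == b v)]].
  by exists S => v vu; apply/eqP; have := SP v; rewrite vu.
rewrite negb_exists => /forallP noS.
(* [j] maps each fibre of [tail D] outside [u] onto the nonzero residues. *)
pose fib v := enum [pred e | tail D e == v].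
pose j e : 'F_p := (index e (fib (tail D e))).+1%:R.
have jP v (y : 'F_p) : v != u -> y != 0 -> exists2 e, tail D e = v & j e = y.
  move=> vu y0; have sz : size (fib v) = (p - 1)%N by rewrite -cardE card_fib.
  have y_lt : (y < p)%N by rewrite -[X in (_ < X)%N](Fp_cast p_pr) ltn_ord.
  have y_gt : (0 < y)%N by rewrite lt0n; apply: contra y0 => /eqP yE; apply/eqP/val_inj.
  have lt1 : (y.-1 < size (fib v))%N by rewrite sz subn1 -ltnS !prednK // prime_gt0.
  have /card_gt0P[e0 _] : (0 < #|[pred e | tail D e == v]|)%N.
    by rewrite cardE; exact: leq_ltn_trans lt1.
  pose e := nth e0 (fib v) y.-1.
  have tE : tail D e = v.
    by have := mem_nth e0 lt1; rewrite mem_enum inE => /eqP.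
  exists e => //; rewrite /j tE index_uniq ?enum_uniq // prednK //.
  exact: natr_Zp.
have := sum_setsign_prod_affine (fun i => - b (tail D i) - j i)
  (fun i e => (tail D e == tail D i)%:R - (head D e == tail D i)%:R).
rewrite permanent_incidence big1; last first.
  (* The boundary of [S] misses [b] at some [v]; the edge of tail [v] whose [j] is the nonzero
     difference gives a zero factor. *)
  move=> S _; have := noS S; rewrite negb_forall => /existsP[v].
  rewrite negb_imply => /andP[vu Lb].
  have [e te je] := jP v (L S v - b v) vu (ltac:(by rewrite subr_eq0)).
  rewrite (bigD1 e) //= te je -/(L S v) opprB addrA addNr.
  by rewrite addrAC -addrA; rewrite ?(addNr, subrr, mul0r, mulr0, add0r, addr0).
move/esym/eqP; rewrite mulf_eq0 signr_eq0 mulf_eq0 subr_eq0 (negPf neqE) orbF /=.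
rewrite -(dvdn_pcharf (pchar_Fp p_pr)) (negPf (prime_ndvd_card_fiber_perm _ _)) // => v.
have [->|/card_fib ->] := eqVneq v u; last by rewrite subn1 prednK // prime_gt0.
by rewrite eq_card0 ?prime_gt0 // => e; rewrite inE (negPf (Nu e)).
Qed.

End Orientation.

Lemma eq_set2 (T : finType) (x y z t : T) : [set x; y] = [set z; t] ->
  if x == z then y = t else x = t /\ y = z.
Proof.
move=> /setP E; have := (E x, E y, E z, E t); rewrite !inE !eqxx !orbT /= => -[[[Ex Ey] Ez] Et].
have [xz|Nxz] := eqVneq x z.
  case/esym/orP: Ey => /eqP // yz; case/orP: Et => /eqP // tx.
  by rewrite yz tx.
move: Ex Ez; rewrite (negPf Nxz) (eq_sym z) (negPf Nxz) /= => /esym/eqP xt /eqP.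
by split.
Qed.

(** * From arc sets of [H] to nowhere-zero functions on [G] *)

Section SpanningSubgraphFlow.
Local Open Scope ring_scope.
Variables (p k : nat) (G : graph) (F : {set edge (multiply G k)}).
Let H := spanning_subgraph F.
Variables (D0 : orientation G) (D : orientation H).

Let origin (f : edge H) : edge G := (val f).1.
Let agree (f : edge H) : bool := tail D f == tail D0 (origin f).

(* Up to a constant, the sum of the signed copies of [e] lying in [S]; the constant,
   one plus the number of copies oriented against [D0], makes it a number between
   1 and [k + 1]. *)
Definition copies_flow (S : {set edge H}) (e : edge G) : 'F_p :=
  #|[set f : edge H | (origin f == e) && ((f \in S) == agree f)]|.+1%:R.

Lemma copies_flow_neq0 (S : {set edge H}) (e : edge G) :
  prime p -> (k.+1 < p)%N -> copies_flow S e != 0.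
Proof.
move=> p_pr ltkp; rewrite /copies_flow; set A := [set f | _].
have leA : (#|A| <= k)%N.
  rewrite -[X in (_ <= X)%N]card_ord -(card_in_imset (f := fun f => (val f).2) (D := A)).
    exact: max_card.
  move=> f g; rewrite !inE => /andP[/eqP fe _] /andP[/eqP ge _] fg.
  apply/val_inj; move: fe ge fg; rewrite /origin.
  by case: (val f) (val g) => ? ? [? ?] /= -> -> ->.
rewrite -(dvdn_pcharf (pchar_Fp p_pr)) gtnNdvd //.
by apply: leq_ltn_trans ltkp.
Qed.

(** Putting a copy [f] into [S] changes the value on its edge by [1] if [f] agrees with [D0] and by
    [-1] otherwise, which adds the boundary of the arc [f] of [D]. *)
Lemma copies_flow_boundary (S : {set edge H}) (v : vertex G) :
  \sum_(e | tail D0 e == v) copies_flow S e - \sum_(e | head D0 e == v) copies_flow S e =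
  \sum_(e | tail D0 e == v) copies_flow set0 e - \sum_(e | head D0 e == v) copies_flow set0 e
  + \sum_(f in S) ((tail D f == v)%:R - (head D f == v)%:R).
Proof.
pose w e : 'F_p := (tail D0 e == v)%:R - (head D0 e == v)%:R.
have boundaryE (phi : edge G -> 'F_p) :
    \sum_(e | tail D0 e == v) phi e - \sum_(e | head D0 e == v) phi e = \sum_e phi e * w e.
  rewrite !(big_mkcond (fun e => _ == v)) -sumrB; apply: eq_bigr => e _.
  rewrite /w mulrBr.
  by case: (tail D0 e == v); case: (head D0 e == v); rewrite ?mulr1 ?mulr0.
rewrite !boundaryE.
have flowE e : copies_flow S e =
    copies_flow set0 e + \sum_(f in S | origin f == e) (if agree f then 1 else -1).
  have cardE (P : pred (edge H)) : #|[set f | P f]|%:R = \sum_f (P f)%:R :> 'F_p.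
    by rewrite -natr_sum -sum1dep_card [in LHS]big_mkcond.
  rewrite /copies_flow -!natr1 addrAC; congr (_ + 1).
  rewrite !cardE [X in _ + X]big_mkcond -big_split /=; apply: eq_bigr => f _.
  rewrite inE; case: (_ == e); case: (f \in S); case: (agree f) => //=;
  by rewrite ?addr0 ?add0r ?subrr.
under eq_bigr do rewrite flowE mulrDl big_distrl /=.
rewrite big_split /=; congr (_ + _).
rewrite (exchange_big_dep (mem S)) /=; last by move=> e f _ /andP[].
apply: eq_bigr => f fS; rewrite (big_pred1 (origin f)); last first.
  by move=> e; rewrite fS /= eq_sym.
have := ends_orientation D f; rewrite /= -/(origin f) (ends_orientation D0 (origin f)).
move/esym/eq_set2; rewrite /w /agree.
case: eqP => [-> ->|_ [-> ->]]; first by rewrite mul1r.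
by rewrite mulN1r opprB.
Qed.

End SpanningSubgraphFlow.

(** * Global sums and residues *)

Section Sums.
Local Open Scope ring_scope.

Lemma sum_boundary (A : zmodType) (G : graph) (D : orientation G) (phi : edge G -> A) :
  \sum_v (\sum_(e | tail D e == v) phi e - \sum_(e | head D e == v) phi e) = 0.
Proof.
have sum_fibers (g : edge G -> vertex G) :
    \sum_v \sum_(e | g e == v) phi e = \sum_e phi e.
  by rewrite [RHS](partition_big g predT).
by rewrite sumrB !sum_fibers subrr.
Qed.

Lemma sum_outdeg (G : graph) (D : orientation G) : (\sum_v outdeg D v)%N = #|edge G|.
Proof.
rewrite -sum1_card (partition_big (tail D) predT) //=; apply: eq_bigr => v _.
by rewrite sum1dep_card; apply: eq_card => e; rewrite !inE.
Qed.

Lemma natr_Fp_eq (p m n : nat) : prime p ->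
  (m%:R == n%:R :> 'F_p) = (m%:Z - n%:Z == 0 %[mod p])%Z.
Proof.
move=> p_pr; rewrite intdiv.eqz_mod_dvd subr0 -intdiv.eqz_mod_dvd !intdiv.modz_nat eqz_nat.
by rewrite -val_eqE /= !val_Fp_nat.
Qed.

End Sums.

Theorem theorem8 (p : nat) (p_prime : prime p) (p_ge3 : (3 <= p)%N) (G : graph)
  (F : {set edge (multiply G (p - 2))})
  (card_F : #|F| = ((p - 1) * (#|vertex G| - 1))%N) :
  let H := spanning_subgraph F in
  (exists (u : vertex H) (D : orientation H),
     (forall v : vertex G, v != u -> outdeg D v = (p - 1)%N) /\
     ((EE D)%:Z - (EO D)%:Z != 0 %[mod p])%Z) ->
  group_connected 'F_p G.
Proof.
move=> H [u [D [outD neqE]]] D0 b sum_b.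
(* The other vertices already account for all [(p - 1) * (#|V| - 1)] arcs. *)
have outDu : outdeg D u = 0%N.
  have := sum_outdeg D; rewrite (bigD1 u) //= (eq_bigr _ outD) sum_nat_const.
  rewrite [X in _ = X -> _](_ : _ = #|F|); last by rewrite card_sig.
  rewrite card_F mulnC subn1 (_ : #|_| = (#|vertex G|.-1)%N); last first.
    by rewrite -(cardC1 u); apply: eq_card.
  by rewrite subn1 -[RHS]add0n => /addIn.
have Nu e : tail D e != u.
  apply: contraTneq isT => eu; move/eqP: outDu.
  by rewrite /outdeg cards_eq0 => /eqP/setP/(_ e); rewrite !inE eu eqxx.
(* The boundary for the empty set is the constant to subtract from the target [b]. *)
pose b0 v := (\sum_(e | tail D0 e == v) copies_flow p D0 D set0 e
              - \sum_(e | head D0 e == v) copies_flow p D0 D set0 e)%R.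
have [|S SP] := @exists_set_boundary H D p u (fun v => b v - b0 v)%R p_prime outD Nu.
  by rewrite natr_Fp_eq.
have boundaryE v : v != u ->
    (\sum_(e | tail D0 e == v) copies_flow p D0 D S e
     - \sum_(e | head D0 e == v) copies_flow p D0 D S e)%R = b v.
  by move=> vu; rewrite copies_flow_boundary SP // addrC subrK.
exists (copies_flow p D0 D S); split.
  move=> e; apply: copies_flow_neq0 => //.
  by rewrite -subSn ?(ltnW p_ge3) // subSS ltn_subrL /= prime_gt0.
move=> v; have [->|] := eqVneq v u; last exact: boundaryE.
(* The value at [u] is forced, since both sides have total zero. *)
have := sum_boundary D0 (copies_flow p D0 D S).
rewrite (bigD1 u) //= (eq_bigr _ boundaryE) -[RHS]sum_b [in RHS](bigD1 u) //=.
exact: addIr.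
Qed.
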